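(* Let $p>r>2$ be primes, let $G=G_{r,p}$ and $H=G/O_r(G)$. Let $V$ be the group $O_r(G)$ regarded as a vector space over $\mathbb{F}_r$, on which $H$ acts via the conjugation action of $G$. Then the following are equivalent: $(1)$ there exists a faithful unisingular irreducible representation of $G$ over a field of characteristic $\ell\neq r$; $(2)$ $V=\bigcup_{h\in H} hW$ for some subspace $W$ of $V$ of codimension $1$.
   Context: For distinct primes $p,r$, $G_{r,p}$ denotes the non-abelian group of minimal order among non-abelian groups of order $r^dp$ ($d\ge 1$) having a normal $r$-subgroup $A$ of index $p$. The group is unique up to isomorphism; $A=O_r(G)$ is an elementary abelian $r$-group of rank $d$, where $d$ is the order of $r$ modulo $p$, and the conjugation action of $G$ on $A$ is irreducible. $O_r(G)$ is the largest normal $r$-subgroup of $G$. A representation $\phi$ of a finite group $G$ over a field is called unisingular if $\phi(g)$ has eigenvalue $1$ for every $g\in G$.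
   Formalization: G_{r,p} is taken of minimal order among non-abelian groups of order r^d p whose normal r-subgroup A of index p is elementary abelian; without this, 3^{1+2} x C_11 (r=3, p=11) would be smaller than the intended group and V would not be a vector space. *)

(* Defs.v *)
From mathcomp Require Export all_boot all_order all_algebra all_fingroup.
From mathcomp Require Export all_solvable all_field all_character.

Set Implicit Arguments.
Unset Strict Implicit.
Unset Printing Implicit Defensive.

Import GroupScope GRing.Theory.
Local Open Scope ring_scope.

(* A is required to be elementary abelian, as O_r(G_{r,p}) should be.  If any
   normal r-subgroup A were admitted, the direct product of an extraspecial
   group of order r^3 with C_p would be smaller than the intended group
   whenever the order of r modulo p exceeds 3. *)
Definition Grp_candidate (r p : nat) (gT : finGroupType) (G : {group gT}) :=
  [/\ ~~ abelian G,
      exists2 d : nat, (1 <= d)%N & #|G| = (r ^ d * p)%N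
    & exists A : {group gT}, [/\ A <| G, r.-abelem A & #|G : A| = p]].

(* G is (a copy of) the group G_{r,p}. *)
Definition is_Grp (r p : nat) (gT : finGroupType) (G : {group gT}) : Prop :=
  [/\ [/\ prime r, prime p & r != p],
      Grp_candidate r p G
    & forall (hT : finGroupType) (K : {group hT}),
        Grp_candidate r p K -> (#|G| <= #|K|)%N].

Definition unisingular (F : fieldType) (gT : finGroupType) (G : {group gT})
    (n : nat) (phi : mx_representation F G n) : Prop :=
  forall g, g \in G -> eigenvalue (phi g) 1.

Lemma Grp_candidateI (r p : nat) (gT : finGroupType) (G A : {group gT}) :
    prime r -> prime p -> ~~ abelian G ->
    A <| G -> r.-abelem A -> #|G : A| = p -> Grp_candidate r p G.
Proof.
move=> pr_r pr_p nabG nsAG abelA iAG; split=> //; last by exists A.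
have oG : #|G| = (#|A| * p)%N by rewrite -iAG Lagrange ?normal_sub.
have [d oA] := p_natP (abelem_pgroup abelA).
exists d; last by rewrite oG oA.
case: d oA => // oA; case/negP: nabG; apply/cyclic_abelian/prime_cyclic.
by rewrite oG oA mul1n.
Qed.

Section ConjugationModule.

Variables (r p : nat) (gT : finGroupType) (G : {group gT}).
Hypothesis defG : is_Grp r p G.

Let V : {group gT} := 'O_r(G)%G.

Lemma pcore_Grp :
  exists A : {group gT}, [/\ V :=: A, A <| G, r.-abelem A & #|G : A| = p].
Proof.
have [[pr_r pr_p neq_rp] [_ _ [A [nsAG abelA iAG]]] _] := defG.
exists A; split=> //; apply: normal_Hall_pcore => //.
rewrite /pHall normal_sub // (abelem_pgroup abelA) iAG p'natE //.
by rewrite dvdn_prime2.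
Qed.

Lemma abelem_pcore_Grp : r.-abelem V.
Proof. by have [A [-> _ ]] := pcore_Grp. Qed.

Lemma index_pcore_Grp : #|G : V| = p.
Proof. by have [A [-> _ ]] := pcore_Grp. Qed.

Lemma ntriv_pcore_Grp : V :!=: 1%g.
Proof.
have [[_ pr_p _] [/negP nabG _ _] _] := defG.
apply/eqP=> V1; apply: nabG; apply/cyclic_abelian/prime_cyclic.
by rewrite -indexg1 -V1 index_pcore_Grp.
Qed.

Lemma norm_pcore_Grp : G \subset 'N(V).
Proof. exact: gFnorm. Qed.

(* The right action v |-> v ^ g = g^-1 * v * g of G on V, where the elements of
   V are identified with row vectors over 'F_r by abelem_rV. *)
Definition Grp_repr :=
  abelem_repr abelem_pcore_Grp ntriv_pcore_Grp norm_pcore_Grp.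

Lemma pcore_sub_rker_Grp : V \subset rker Grp_repr.
Proof.
rewrite rker_abelem subsetI pcore_sub.
exact: abelem_abelian abelem_pcore_Grp.
Qed.

(* The induced action of H = G / O_r(G) on V. *)
Definition Grp_quo_repr := quo_repr pcore_sub_rker_Grp norm_pcore_Grp.

Lemma minnormal_pcore_Grp : minnormal V G.
Proof.
have [[pr_r pr_p neq_rp] [nabG _ _] minG] := defG.
have abelV := abelem_pcore_Grp; have cVV := abelem_abelian abelV.
have sVG : V \subset G := pcore_sub _ _.
have nsVG : V <| G := pcore_normal _ _.
have hallV : r.-Hall(G) V.
  rewrite /pHall sVG (abelem_pgroup abelV) index_pcore_Grp p'natE //.
  by rewrite dvdn_prime2.
apply/mingroupP; split=> [|U /andP[ntU nUG] sUV].
  by rewrite ntriv_pcore_Grp norm_pcore_Grp.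
have [P /complP[tiVP defVP]] := splitsP (SchurZassenhaus_split
  (pHall_Hall hallV) nsVG).
have sPG : P \subset G by rewrite -defVP mulG_subr.
have oP : #|P| = p by rewrite -index_pcore_Grp -(divgS sVG) -defVP
  (TI_cardMg tiVP) mulKn ?cardG_gt0.
have nVP : P \subset 'N(V) := subset_trans sPG norm_pcore_Grp.
have nUP : P \subset 'N(U) := subset_trans sPG nUG.
have sUG := subset_trans sUV sVG.
have coVP : coprime #|V| #|P|.
  by rewrite oP (pnat_coprime (abelem_pgroup abelV)) // p'natE // dvdn_prime2.
apply/eqP; apply: contraT => neqUV.
have ltUV : (#|U| < #|V|)%N.
  by rewrite proper_card // properEneq neqUV.
have oG : #|G| = (#|V| * p)%N by rewrite -defVP (TI_cardMg tiVP) oP.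
have tiUP : U :&: P = 1%g by apply/trivgP; rewrite -tiVP setSI.
have oUP : #|U <*> P| = (#|U| * p)%N.
  by rewrite norm_joinEr // (TI_cardMg tiUP) oP.
have cUP : abelian (U <*> P).
  apply: contraLR ltUV => nabUP; rewrite -leqNgt.
  rewrite -(leq_pmul2r (prime_gt0 pr_p)) -oG -oUP; apply: minG.
  apply: (Grp_candidateI pr_r pr_p nabUP (A := U)).
  - by rewrite /normal joing_subl join_subG normG nUP.
  - exact: abelemS abelV.
  by rewrite -(divgS (joing_subl U P)) oUP mulKn ?cardG_gt0.
have cGU : abelian (G / U).
  apply: contraT => nabGU; have := minG _ (G / U)%G.
  rewrite leqNgt ltn_quotient //=; apply.
  apply: (Grp_candidateI pr_r pr_p nabGU (A := (V / U)%G)).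
  - exact: quotient_normal.
  - exact: quotient_abelem.
  by rewrite /= index_quotient_eq ?index_pcore_Grp // subIset ?sUV ?orbT.
have sVPU : [~: V, P] \subset U.
  rewrite (subset_trans (commgSS sVG sPG)) //.
  by rewrite -quotient_cents2 //; move: cGU.
have cVP : [~: V, P] = 1%g.
  apply/trivgP; rewrite -(coprime_abel_cent_TI nVP coVP cVV) subsetI subxx /=.
  apply: subset_trans sVPU (sub_abelian_cent2 cUP _ _).
    exact: joing_subl.
  exact: joing_subr.
case/negP: nabG; rewrite -defVP abelianM cVV /=.
apply/andP; split; first exact: abelianS (joing_subr U P) cUP.
by rewrite centsC; apply/commG1P.
Qed.

End ConjugationModule.

(* Main.v *)
(** V = O_r(G) is abelian of prime index p and minimal normal in G.

    (1) => (2): by Clifford, the representation space is a sum of conjugates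
    S x of a simple V-submodule S.  The image of V in GL(S) is cyclic of order
    r, so the kernel W of V on S has index r.  Each v in V acts on S x either
    trivially or with v - 1 invertible; as v has eigenvalue 1, it is trivial on
    some S x, i.e., it lies in a conjugate of W.

    (2) => (1): induce to G a linear character of V with kernel W.  W is
    neither trivial nor normal in G, so the inertia group is V, the induced
    character chi is irreducible, and its kernel, the core of W, is trivial.
    An element v of V lies in the kernel of a conjugate constituent of chi on
    V.  If g is not in V then C_V(g) = 1, so <g> meets V trivially, chi
    vanishes on <g> outside 1, and chi on <g> is a multiple of the regular
    character.  *)

Require Import Defs.

Import GroupScope GRing.Theory Num.Theory.
Local Open Scope abelem_scope.
Local Open Scope ring_scope.

(* The conclusion is boolean because simple submodules exist only classically
   over a field F with undecidable theory. *)
Lemma unisingular_conj_cover {F : fieldType} {r n : nat} {gT : finGroupType}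
    {G V : {group gT}} {phi : mx_representation F G n} :
    V <| G -> r.-abelem V -> mx_irreducible phi -> unisingular phi ->
    ~~ (V \subset rker phi) ->
  [exists W : {group gT}, [&& W \subset V, #|V : W| == r
     & V \subset \bigcup_(x in G) W :^ x]].
Proof.
move=> nsVG abelV irr_phi uni ntV.
have [sVG nVG] := andP nsVG; have cVV := abelem_abelian abelV.
have nz1 : (1%:M : 'M[F]_n) != 0 by case: irr_phi.
pose phiV := subg_repr phi (normal_sub nsVG).
apply: (mxsimple_exists (mxmodule1 phiV) nz1) => [[S simS _]].
have [X sXG [sumS _]] := Clifford_basis irr_phi simS.
(* Equality of matrices, rather than of row spaces, says that [v] fixes this conjugate of [S]
   pointwise. *)
have conjS x v : x \in G -> v \in V ->
  (S *m phi x *m phi v == S *m phi x) = (v \in rstab phiV S :^ x).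
  move=> Gx Vv; have Gv := subsetP sVG v Vv.
  rewrite mem_conjg inE memJ_norm ?groupV ?(subsetP nVG) // Vv /=.
  rewrite (_ : (v ^ x^-1)%g = (x * v * x^-1)%g); last first.
    by rewrite conjgE invgK mulgA.
  rewrite !repr_mxM ?groupM ?groupV // !mulmxA.
  by apply/eqP/eqP=> [->|eqS]; rewrite ?repr_mxK // -{2}eqS repr_mxKV.
have modS : mxmodule phiV S by case: simS.
have ker_n : rstab phiV S \subset V by apply: rstab_sub.
have nsKV : rstab phiV S <| V by rewrite -sub_abelian_normal.
apply/existsP; exists (rstab_group phiV S); apply/and3P; split=> //=.
  rewrite -card_quotient ?normal_norm //; apply/eqP.
  (* By Schur's lemma an abelian group with a faithful irreducible module is cyclic. A nontrivial
     cyclic elementary abelian [r]-group has order [r]. *)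
  apply: cyclic_abelem_prime; first exact: quotient_abelem.
    have irrS : mx_irreducible (submod_repr modS) by apply/submod_mx_irr.
    have := center_kquo_cyclic irrS; rewrite rker_submod.
    by move/center_idP: (quotient_abelian (rstab phiV S) cVV) => ->.
  apply: contra ntV; rewrite -subG1 quotient_sub1 ?normal_norm // => sVK.
  apply/subsetP=> v Vv; have Gv := subsetP sVG v Vv.
  apply/rkerP; split=> //; apply/eqP; rewrite -subr_eq0 -submx0.
  rewrite -[phi v - 1%:M]mul1mx -(eqmxMr _ sumS) sumsmxMr.
  apply/sumsmx_subP=> x Xx; have Gx := subsetP sXG x Xx.
  rewrite mulmxBr mulmx1 submx0 subr_eq0 conjS //.
  by rewrite mem_conjg (subsetP sVK) // memJ_norm ?groupV ?(subsetP nVG).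
apply/subsetP=> v Vv; have Gv := subsetP sVG v Vv.
apply: contraT => ncov; have /eigenvalueP[u] := uni v Gv.
rewrite scale1r => fixu; case/negP; rewrite -[u]mulmx1.
(* Since [phi v - 1] commutes with the action of [V], it maps each simple summand [S *m phi x] to a
   submodule of it, which is nonzero because [v] avoids all conjugates of the kernel. So it is onto
   each summand, hence invertible, and the fixed vector [u] vanishes. *)
have: row_free (phi v - 1%:M).
  rewrite row_free_unit -row_full_unit -sub1mx.
  rewrite -[X in (_ <= X)%MS]mul1mx -(eqmxMr _ sumS) sumsmxMr -sumS.
  apply/sumsmx_subP=> x Xx; apply: (sumsmx_sup x) => //.
  have Gx := subsetP sXG x Xx.
  have [modSx nzSx minSx] := Clifford_simple simS Gx.
  have sSx: (S *m phi x *m phi v <= S *m phi x)%MS by apply: (mxmoduleP modSx).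
  apply: minSx.
  - apply/mxmoduleP=> w Vw; have Gw := subsetP sVG w Vw.
    have cwv: phi v *m phi w = phi w *m phi v.
      by rewrite -!repr_mxM // (centsP cVV v Vv w Vw).
    rewrite -mulmxA mulmxBl mul1mx cwv -[X in _ - X]mulmx1 -mulmxBr mulmxA.
    by rewrite submxMr ?(mxmoduleP modSx).
  - by rewrite mulmxBr mulmx1 addmx_sub ?eqmx_opp.
  rewrite mulmxBr mulmx1 subr_eq0 conjS //.
  by apply: contra ncov => Kv; apply/bigcupP; exists x.
move/row_freeP=> [B def1]; rewrite -def1 mulmxA mulmxBr mulmx1 fixu.
by rewrite subrr mul0mx.
Qed.

(** The sum [S] of [rG h] over [<[g]>] has trace [#|<[g]>|] times the inner product, so it is
    nonzero, and its rows are fixed by [g]. *)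
Lemma eigenvalue1_Res_cycle {gT : finGroupType} {G : {group gT}} {n : nat}
    {rG : mx_representation algC G n} {g : gT} :
  g \in G -> '['Res[<[g]>] (cfRepr rG), 1] != 0 -> eigenvalue (rG g) 1.
Proof.
move=> Gg nz; have sgG : <[g]> \subset G by rewrite cycle_subG.
pose S := \sum_(h in <[g]>) rG h.
have fixS : S *m rG g = S.
  rewrite mulmx_suml [RHS](reindex_inj (mulIg g)) /=.
  apply: eq_big => [h|h gh]; first by rewrite groupMr ?cycle_id.
  by rewrite repr_mxM // (subsetP sgG).
have nzS : S != 0.
  apply: contraNneq nz => S0.
  suffices ->: '['Res[<[g]>] (cfRepr rG), 1] = #|<[g]>|%:R^-1 * \tr S.
    by rewrite S0 mxtrace0 mulr0.
  rewrite cfdotE; congr (_ * _).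
  rewrite /S raddf_sum; apply: eq_bigr => h gh.
  by rewrite cfResE // cfunE (subsetP sgG) // cfun1E gh conjC1 mulr1 mulr1n.
apply/eigenvalueP; exists (nz_row S); last by rewrite nz_row_eq0.
rewrite scale1r /nz_row; case: pickP => [i _|_].
  by rewrite -row_mul fixS.
by rewrite mul0mx.
Qed.

(** This is the Clifford correspondence when the inertia group is [H] itself, so that the only
    character of it above ['chi_i] is ['chi_i]. *)
Lemma inertia_Ind_irr {gT : finGroupType} {G H : {group gT}} {i : Iirr H} :
  H <| G -> 'I_G['chi_i] \subset H -> 'Ind[G] 'chi_i \in irr G.
Proof.
move=> nsHG sIH.
have defI : 'I_G['chi_i]%G = H.
  by apply/val_inj/eqP; rewrite eqEsubset sIH sub_Inertia ?normal_sub.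
have [+ _ _ _ _] := constt_Inertia_bijection i nsHG.
rewrite defI => irrI; apply: irrI.
by rewrite cfInd_id irr_consttE cfnorm_irr oner_eq0.
Qed.

(** [W] is the intersection of the irreducible kernels containing it, so one of these is proper in
    [V]. It equals [W], which is maximal because its index is prime. *)
Lemma irr_with_cfker {gT : finGroupType} {V W : {group gT}} :
    W <| V -> prime #|V : W| -> exists i : Iirr V, cfker 'chi_i = W.
Proof.
move=> nsWV pr_VW; have [sWV _] := andP nsWV.
have [i sWi nsVi] : exists2 i : Iirr V, W \subset cfker 'chi_i &
    ~~ (V \subset cfker 'chi_i).
  apply/exists_inP; apply: contraT => /exists_inPn sVker.
  have: V \subset W.
    rewrite -(cap_cfker_normal nsWV); apply/bigcapsP=> i Wi.
    by have := sVker i Wi; rewrite negbK.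
  by rewrite -indexg_eq1 => /eqP VW1; rewrite VW1 in pr_VW.
exists i; have /maxgroupP[_ maxW] := p_index_maximal sWV pr_VW.
by apply: (maxW (cfker_group 'chi_i)) => //=; rewrite properE cfker_sub.
Qed.

Lemma conj_cover_unisingular {gT : finGroupType} {G V W : {group gT}} :
    V <| G -> abelian V -> prime #|G : V| -> minnormal V G -> ~~ abelian G ->
    W \subset V -> prime #|V : W| -> V \subset \bigcup_(x in G) W :^ x ->
  exists i : Iirr G, mx_faithful 'Chi_i /\ unisingular 'Chi_i.
Proof.
move=> nsVG cVV pr_GV /mingroupP[/andP[ntV _] minV] nabG sWV pr_VW covV.
have [sVG nVG] := andP nsVG.
have /maxgroupP[ltVG maxV] := p_index_maximal sVG pr_GV.
have maxVeq (H : {group gT}) : H \subset G -> V \subset H -> H :=: V \/ H :=: G.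
  rewrite subEproper => /predU1P[-> | ltHG] sVH; first by right.
  by left; apply: maxV.
have ltWV : W \proper V.
  rewrite properEneq sWV andbT; apply: contraTneq pr_VW => ->.
  by rewrite indexgg.
have normal_sub_W (N : {group gT}) :
  G \subset 'N(N) -> N \subset W -> N :=: 1%g.
  move=> nNG sNW; apply/eqP; apply: contraT => ntN.
  have defN := minV N; rewrite ntN nNG (subset_trans sNW) // in defN.
  by move: ltWV; rewrite properE -defN // sNW andbF.
have ntW : W :!=: 1%g.
  apply: contraNneq ntV => W1; rewrite -subG1 (subset_trans covV) //.
  by apply/bigcupsP=> x _; rewrite W1 conjs1g.
(* The centraliser of ['C_V[g]] contains [V] and [g], so it is [G]. If ['C_V[g]] were nontrivial,
   minimality would make it all of [V]; then [V] is central with cyclic quotient, and [G] is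
   abelian. *)
have nCV (g : gT) : g \in G -> g \notin V -> 'C_V[g] = 1%g.
  move=> Gg notVg; have sCV : 'C_V[g] \subset V by apply: subsetIl.
  have [eqV | eqG] : 'C_G('C_V[g]) = V \/ 'C_G('C_V[g]) = G.
    apply: (maxVeq 'C_G('C_V[g])%G); first exact: subsetIl.
    by rewrite subsetI sVG (sub_abelian_cent cVV).
  - case/negP: notVg; rewrite -eqV inE Gg /=; apply/centP=> x /setIP[_ /cent1P].
    exact: commute_sym.
  have cGC : G \subset 'C('C_V[g]) by rewrite -eqG subsetIr.
  apply/eqP; apply: contraT => ntC; case/negP: nabG.
  have defC : 'C_V[g] = V.
    apply: (minV 'C_V[g]%G) => //.
    by rewrite ntC /= (subset_trans cGC) ?cent_sub.
  rewrite defC in cGC; apply: (@cyclic_factor_abelian _ V).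
    by rewrite subsetI sVG centsC.
  by rewrite prime_cyclic ?card_quotient.
have [j kerj] : exists j : Iirr V, cfker 'chi_j = W.
  by apply: irr_with_cfker; rewrite // -sub_abelian_normal.
(* Otherwise ['chi_j] is [G]-invariant, and its kernel [W] is normalised by [G]. *)
have sIV : 'I_G['chi_j] \subset V.
  have [-> //| defI] :=
    maxVeq _ (subsetIl G 'I['chi_j]) (sub_Inertia 'chi_j sVG).
  case/eqP: ntW; apply: normal_sub_W => //; rewrite -kerj.
  apply/normsP=> x Gx; rewrite -cfker_conjg ?(subsetP nVG) // inertiaJ //.
  by move: Gx; rewrite -{1}defI => /setIP[].
have [i def_i] := irrP (inertia_Ind_irr nsVG sIV).
exists i; split=> [|g Gg].
  rewrite /mx_faithful -cfker_repr irrRepr -def_i cfker_Ind_irr // subG1.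
  by apply/eqP/normal_sub_W; [exact: gcore_norm | rewrite -kerj gcore_sub].
apply: eigenvalue1_Res_cycle => //; rewrite irrRepr.
have sgG : <[g]> \subset G by rewrite cycle_subG.
have [Vg | notVg] := boolP (g \in V).
  have [x Gx Wxg] := bigcupP (subsetP covV g Vg).
  (* This conjugate of ['chi_j] has kernel [W :^ x], which contains [g], so it restricts to the
     trivial character of [<[g]>]. *)
  pose k := conjg_Iirr j x.
  have kRes : k \in irr_constt ('Res[V] 'chi_i).
    rewrite -constt_Ind_Res conjg_IirrE -(cfclass_Ind (phi := 'chi_j)) //.
      by rewrite def_i irr_consttE cfnorm_irr oner_eq0.
    by apply/cfclassP; exists x.
  rewrite -irr0 -irr_consttE.
  have sgV : <[g]> \subset V by rewrite cycle_subG.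
  rewrite -(cfResRes _ sgV sVG) (constt_Res_trans _ kRes) //.
    by rewrite cfRes_char ?irr_char.
  rewrite (_ : 'Res[<[g]>] 'chi_k = 1) ?irr_consttE ?irr0 ?cfnorm1 ?oner_eq0 //.
  have sgk : <[g]> \subset cfker 'chi_k.
    by rewrite cycle_subG /k conjg_IirrE /= cfker_conjg ?(subsetP nVG) // kerj.
  apply/cfun_inP=> h gh; rewrite cfResE // cfun1E gh.
  by rewrite cfker1 ?(subsetP sgk) // lin_char1 //; apply/char_abelianP.
(* Only the term of the identity survives in the sum. *)
rewrite cfdotE mulf_neq0 ?invr_eq0 ?neq0CG //.
rewrite (big_setD1 1%g) //= big1 ?addr0.
  by rewrite cfResE // cfun1E group1 conjC1 mulr1 irr1_neq0.
move=> h /setD1P[nth gh]; rewrite cfResE // -def_i.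
rewrite (cfun_on0 (cfInd_normal _ nsVG)) ?mul0r //.
apply: contra nth => Vh; have: h \in 'C_V[g].
  by rewrite inE Vh; apply/cent1P/(centsP (cycle_abelian g)); rewrite ?cycle_id.
by rewrite nCV // => /set1gP->.
Qed.

(** Over a prime field every subgroup is a subspace, so hyperplanes are the subgroups of index [r],
    and the linear action on them is conjugation. *)
Lemma hyperplane_coverP {r : nat} {gT : finGroupType} {E G : {group gT}}
    (pr_r : prime r) (abelE : r.-abelem E) (ntE : E :!=: 1%g)
    (nEG : G \subset 'N(E)) :
  (exists U : 'M['F_r](E), (\rank U).+1 = 'dim E /\
     forall v : 'rV['F_r](E), exists2 x, x \in G &
       (v <= U *m abelem_repr abelE ntE nEG x)%MS)
  <-> [exists W : {group gT}, [&& W \subset E, #|E : W| == r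
        & E \subset \bigcup_(x in G) W :^ x]].
Proof.
have r_gt0 := prime_gt0 pr_r.
have mem_conj (U : 'M['F_r](E)) x v : x \in G ->
  (v <= U *m abelem_repr abelE ntE nEG x)%MS =
  (rVabelem abelE ntE v \in (rVabelem abelE ntE @* rowg U) :^ x).
  move=> Gx; rewrite -(abelem_rowgJ abelE ntE nEG) // -mem_rowg.
  apply/idP/morphimP=> [Uv | [u _ Uu /rVabelem_inj->] //].
  by exists v; rewrite ?mem_im_abelem_rV.
have cardE : #|E| = (r ^ 'dim E)%N.
  rewrite (dim_abelemE abelE ntE) -p_part.
  by rewrite (part_pnat_id (abelem_pgroup abelE)).
split=> [[U [rankU coverU]] | /existsP[W /and3P[sWE /eqP indexW coverW]]].
  pose W := (rVabelem abelE ntE @* rowg U)%G.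
  have sWE : W \subset E.
    by apply/subsetP=> _ /morphimP[v _ _ ->]; apply: mem_rVabelem.
  apply/existsP; exists W; rewrite sWE /=; apply/andP; split.
    have cardW : #|W| = (r ^ \rank U)%N.
      rewrite card_injm ?rVabelem_injm ?sub_im_abelem_rV //.
      by rewrite card_rowg card_Fp.
    have -> : #|E : W| = (r ^ (\rank U).+1 %/ r ^ \rank U)%N.
      by rewrite -divgS // cardW rankU cardE.
    by rewrite expnS mulnK ?expn_gt0 ?r_gt0.
  apply/subsetP=> y Ey; have [x Gx] := coverU (abelem_rV abelE ntE y).
  by rewrite mem_conj // abelem_rV_K // => Wy; apply/bigcupP; exists x.
exists (rowg_mx (abelem_rV abelE ntE @* W)); split=> [|v].
  rewrite mxrank_rowg // card_injm ?abelem_rV_injm //.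
  apply/eqP; rewrite -(eqn_exp2l _ _ (prime_gt1 pr_r)) -cardE expnSr.
  rewrite -(Lagrange sWE) indexW -p_part part_pnat_id //.
  exact: pgroupS sWE (abelem_pgroup abelE).
have /bigcupP[x Gx Wv] := subsetP coverW _ (mem_rVabelem abelE ntE v).
by exists x => //; rewrite mem_conj // rowg_mxK abelem_rV_mK.
Qed.

(* (1) quantifies over all fields F of characteristic different from r,
   characteristic 0 included. *)
Theorem lemma1p7 (p r : nat) (gT : finGroupType) (G : {group gT})
    (pr_p : prime p) (pr_r : prime r) (r_gt2 : (2 < r)%N) (ltrp : (r < p)%N)
    (defG : is_Grp r p G) :
  (exists (F : fieldType) (n : nat) (phi : mx_representation F G n),
      [/\ r \notin [pchar F], mx_faithful phi, mx_irreducible phi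
        & unisingular phi])
  <->
  (exists W : 'M['F_r]('O_r(G)),
      (\rank W).+1 = 'dim 'O_r(G) /\
      (forall v : 'rV['F_r]('O_r(G)),
          exists2 h, h \in (G / 'O_r(G))%g &
            (v <= W *m Grp_quo_repr defG h)%MS)).
Proof.
have abelV := abelem_pcore_Grp defG; have ntV := ntriv_pcore_Grp defG.
have nsVG : 'O_r(G) <| G := pcore_normal r G.
have coverP := hyperplane_coverP pr_r (abelem_pcore_Grp defG)
  (ntriv_pcore_Grp defG) (norm_pcore_Grp r G).
split=> [[F [n [phi [_ ffphi irrphi uniphi]]]] | [U [rankU coverU]]].
  have [|U [rankU coverU]] := coverP.2.
    apply: (unisingular_conj_cover nsVG abelV irrphi uniphi).
    by apply: contra ntV => /subset_trans/(_ ffphi); rewrite subG1.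
  exists U; split=> // v; have [x Gx Uv] := coverU v.
  exists (coset 'O_r(G) x); first exact: mem_quotient.
  by rewrite /Grp_quo_repr quo_repr_coset.
(* Each element of the quotient acts as any of its preimages in [G]. *)
have /coverP/existsP[W /and3P[sWV /eqP indexW coverW]] :
    exists U : 'M['F_r]('O_r(G)), (\rank U).+1 = 'dim 'O_r(G) /\
      forall v : 'rV['F_r]('O_r(G)), exists2 x, x \in G &
        (v <= U *m Grp_repr defG x)%MS.
  exists U; split=> // v; have [_ /morphimP[x _ Gx ->] Uv] := coverU v.
  exists x; rewrite // -(quo_repr_coset (pcore_sub_rker_Grp defG)
    (norm_pcore_Grp r G)) //.
have [| | |i [ffi unii]] := conj_cover_unisingular nsVG (abelem_abelian abelV)
  _ (minnormal_pcore_Grp defG) _ sWV _ coverW.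
- by rewrite (index_pcore_Grp defG).
- by have [_ []] := defG.
- by rewrite indexW.
(* The field [algC] has characteristic 0, which differs from [r]. *)
exists algC, _, 'Chi_i; split=> //; last exact: socle_irr.
by rewrite pchar_num.
Qed.
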